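(* Let $R$ be a local ring with regular maximal ideal. The following are equivalent: (1) $R$ is a quadratic ring such that $R_\infty$ has exactly three maximal ideals. (2) There is a ring $S$ with $R\subseteq S\subseteq Q(R)$ such that (i) $S$ has exactly three maximal ideals, (ii) each maximal ideal of $S$ is principal and regular with residue field isomorphic to $\mathbb{F}_2$, and (iii) $R=k+\operatorname{Jac} S$, where $k$ is the prime subring of $R$.
   Context: All rings are commutative with identity; a local ring is a ring with a unique maximal ideal (not necessarily Noetherian). $Q(R)$ is the total ring of quotients, $\operatorname{Jac} R$ the Jacobson radical. An ideal is regular if it contains a nonzerodivisor. For a regular fractional ideal $I$ (an $R$-submodule of $Q(R)$ containing a nonzerodivisor with $bI\subseteq R$ for some nonzerodivisor $b\in R$), $E(I)=\{q\in Q(R):qI\subseteq I\}$, and $I$ is stable if it is projective as an $E(I)$-module. An extension $R\subseteq S$ is quadratic if $xy\in xR+yR+R$ for all $x,y\in S$. If $\operatorname{Jac} R$ is regular, define $R_0=R$, $R_i=E(\operatorname{Jac} R_{i-1})$ for $i\ge1$, and $R_\infty=\bigcup_{i\ge1}R_i$. $R$ is a quadratic ring if $R$ is local, its maximal ideal is regular and stable, and $R\subseteq R_\infty$ is a quadratic extension. *)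

(* Defs.v *)
(* Everything lives inside an ambient commutative ring Q,
   which is assumed to be (a model of) the total ring of quotients Q(R) of
   the subring R.  Subsets of Q are Prop-valued predicates. *)
From HB Require Import structures.
From mathcomp Require Import all_boot all_order all_algebra.
Set Implicit Arguments. Unset Strict Implicit. Unset Printing Implicit Defensive.
Import GRing.Theory.
Local Open Scope ring_scope.

Section QuadDefs.
Variable Q : comNzRingType.

Definition qset := Q -> Prop.

Definition set_eq (A B : qset) : Prop := forall x, A x <-> B x.
Definition qsubset (A B : qset) : Prop := forall x, A x -> B x.

Definition subring (A : qset) : Prop :=
  A 0 /\ A 1 /\ (forall x y, A x -> A y -> A (x - y)) /\
  (forall x y, A x -> A y -> A (x * y)).

Definition nzd_in (A : qset) (r : Q) : Prop :=
  A r /\ forall x, A x -> r * x = 0 -> x = 0.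

(* Q is the total ring of quotients of the subring R: nonzerodivisors of R
   become units of Q, and every element of Q is a fraction r/s with r in R
   and s a nonzerodivisor of R (this characterizes Q(R) up to isomorphism
   over R). *)
Definition total_quotient_ring (R : qset) : Prop :=
  subring R /\
  (forall s, nzd_in R s -> exists t, s * t = 1) /\
  (forall q, exists r s, R r /\ nzd_in R s /\ q * s = r).

Definition ideal (A I : qset) : Prop :=
  qsubset I A /\ I 0 /\ (forall x y, I x -> I y -> I (x - y)) /\
  (forall a x, A a -> I x -> I (a * x)).

Definition proper (I : qset) : Prop := ~ I 1.

Definition maximal_ideal (A M : qset) : Prop :=
  ideal A M /\ proper M /\
  forall J, ideal A J -> proper J -> qsubset M J -> qsubset J M.

Definition Jac (A : qset) : qset :=
  fun x => A x /\ forall M, maximal_ideal A M -> M x.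

Definition local_ring (A : qset) : Prop :=
  exists M, maximal_ideal A M /\ forall N, maximal_ideal A N -> set_eq N M.

Definition regular_ideal (A I : qset) : Prop := exists x, I x /\ nzd_in A x.

Definition principal_ideal (A I : qset) : Prop :=
  exists m, A m /\ forall x, I x <-> exists s, A s /\ x = m * s.

Definition exactly_three_maximal (A : qset) : Prop :=
  exists M1 M2 M3,
    [/\ maximal_ideal A M1, maximal_ideal A M2 & maximal_ideal A M3] /\
    [/\ ~ set_eq M1 M2, ~ set_eq M1 M3 & ~ set_eq M2 M3] /\
    forall N, maximal_ideal A N -> set_eq N M1 \/ set_eq N M2 \/ set_eq N M3.

Definition Eset (I : qset) : qset := fun q => forall x, I x -> I (q * x).

Record Emodule (E : qset) : Type := EModule {
  mcar :> Type;
  madd : mcar -> mcar -> mcar;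
  mzero : mcar;
  mopp : mcar -> mcar;
  mact : Q -> mcar -> mcar;
  maddA : forall x y z, madd x (madd y z) = madd (madd x y) z;
  maddC : forall x y, madd x y = madd y x;
  madd0 : forall x, madd mzero x = x;
  maddN : forall x, madd (mopp x) x = mzero;
  mact1 : forall x, mact 1 x = x;
  mactA : forall a b x, E a -> E b -> mact a (mact b x) = mact (a * b) x;
  mactDr : forall a x y, E a -> mact a (madd x y) = madd (mact a x) (mact a y);
  mactDl : forall a b x, E a -> E b -> mact (a + b) x = madd (mact a x) (mact b x)
}.

Definition Elinear (E : qset) (M N : Emodule E) (f : M -> N) : Prop :=
  (forall x y, f (madd x y) = madd (f x) (f y)) /\
  (forall a x, E a -> f (mact a x) = mact a (f x)).

(* E-linear maps from the E-submodule P of Q into an E-module N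
   (only the values on P matter) *)
Definition Elinear_on (E P : qset) (N : Emodule E) (h : Q -> N) : Prop :=
  (forall x y, P x -> P y -> h (x + y) = madd (h x) (h y)) /\
  (forall a x, E a -> P x -> h (a * x) = mact a (h x)).

Definition projective_over (E P : qset) : Prop :=
  forall (M N : Emodule E) (g : M -> N), Elinear g ->
    (forall y : N, exists x : M, g x = y) ->
  forall h : Q -> N, Elinear_on P h ->
    exists l : Q -> M, Elinear_on P l /\ forall x, P x -> g (l x) = h x.

Definition regular_fractional_ideal (R I : qset) : Prop :=
  I 0 /\ (forall x y, I x -> I y -> I (x - y)) /\
  (forall a x, R a -> I x -> I (a * x)) /\
  (exists x, I x /\ forall y, x * y = 0 -> y = 0) /\
  (exists b, nzd_in R b /\ forall x, I x -> R (b * x)).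

Definition stable (I : qset) : Prop := projective_over (Eset I) I.

Fixpoint Rseq (R : qset) (n : nat) : qset :=
  match n with
  | O => R
  | S m => Eset (Jac (Rseq R m))
  end.

Definition Rinfty (R : qset) : qset := fun x => exists n, Rseq R n.+1 x.

Definition quadratic_ext (R S : qset) : Prop :=
  forall x y, S x -> S y ->
    exists a b c, [/\ R a, R b, R c & x * y = x * a + y * b + c].

Definition quadratic_ring (R : qset) : Prop :=
  local_ring R /\
  (forall M, maximal_ideal R M ->
     regular_ideal R M /\ regular_fractional_ideal R M /\ stable M) /\
  quadratic_ext R (Rinfty R).

(* the residue field A/M is isomorphic to F_2: there is a surjective ring
   homomorphism A -> F_2 with kernel M (first isomorphism theorem) *)
Definition residue_field_F2 (A M : qset) : Prop :=
  exists f : Q -> 'F_2,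
    [/\ f 1 = 1,
        (forall x y, A x -> A y -> f (x + y) = f x + f y),
        (forall x y, A x -> A y -> f (x * y) = f x * f y),
        (forall z : 'F_2, exists x, A x /\ f x = z) &
        (forall x, A x -> (M x <-> f x = 0))].

(* prime subring of Q (= of R): the image of Z *)
Definition prime_subring : qset := fun x => exists n : int, x = n%:~R.

End QuadDefs.

(* Main.v *)
(* (2) => (1): if the maximal ideals of [S] are generated by [m1], [m2], [m3], then
   [Jac S] is generated by [m = m1 m2 m3] and is the maximal ideal of [R]; since [m]
   is a unit of [Q], [E(Jac S) = S], so [R_n = S] for all [n >= 1].  Quadraticity
   can be checked modulo [Jac S], that is, in [F_2^3].

   (1) => (2): take [S = R_infty], let [M] be the maximal ideal of [R] and [E = R_1].
   Quadraticity and the three maximal ideals force all residue fields to be [F_2],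
   which gives [phi : S -> F_2^3] with kernel [Jac S].
   - Projectivity makes [M] an invertible ideal of [E], and as units of [S] are
     detected by [phi], it is principal: [M = m E].
   - If [x], [y] lift two distinct unit vectors and [j] lies in [Jac S], comparing
     the quadratic relations of [x y] and [(x + j) y] puts [j (y - a)] in
     [M x + M y + M] for some [a] in [M].  Summing over the three choices of
     [y] gives [Jac S = m S].
   - Comparing those of [e^2] and [(e + m s)^2] and cancelling [m] gives
     [phi s] in [phi(E) phi(e) + phi(E)] for all [s] in [S], whenever [phi e] is
     neither 0 nor 1.  Hence [phi(E)] contains such a [phi e], so [phi(E) = phi(S)].
   - Thus [x] and [y] may be chosen in [E], and the second step now gives
     [Jac S = M], so that [R = k + Jac S]. *)
From HB Require Import structures.
From mathcomp Require Import all_boot all_order all_algebra.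
From mathcomp Require Import boolp classical_sets functions ring.
Require Import Defs.
Set Implicit Arguments.
Unset Strict Implicit.
Unset Printing Implicit Defensive.
Import GRing.Theory.
Local Open Scope ring_scope.

(** * Maximal ideals, the Jacobson radical and the chain [Rseq] for subrings of [Q] *)

Section Ideals.
Variable Q : comNzRingType.
Implicit Types (A I M N : Q -> Prop) (x y z : Q).

Lemma set_eqP A I : set_eq A I -> A = I.
Proof. by move=> h; apply/funext => x; apply/propext. Qed.

Lemma subring0 A : subring A -> A 0. Proof. by case. Qed.
Lemma subring1 A : subring A -> A 1. Proof. by case=> _ []. Qed.
Lemma subringB A : subring A -> forall x y, A x -> A y -> A (x - y).
Proof. by case=> _ [_ []]. Qed.
Lemma subringM A : subring A -> forall x y, A x -> A y -> A (x * y).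
Proof. by case=> _ [_ []]. Qed.
Lemma subringN A : subring A -> forall x, A x -> A (- x).
Proof. by move=> hA x Ax; rewrite -sub0r; apply: subringB=> //; apply: subring0. Qed.
Lemma subringD A : subring A -> forall x y, A x -> A y -> A (x + y).
Proof.
by move=> hA x y Ax Ay; rewrite -[y]opprK; apply: subringB=> //; apply: subringN.
Qed.
Lemma subringX A : subring A -> forall x n, A x -> A (x ^+ n).
Proof.
move=> hA x n Ax; elim: n => [|n IH]; first exact: subring1.
by rewrite exprS; apply: subringM.
Qed.
Lemma subring_nat A : subring A -> forall n, A n%:R.
Proof.
move=> hA; elim=> [|n IH]; first exact: subring0.
by rewrite -natr1; apply: subringD=> //; apply: subring1.
Qed.
Lemma subring_int A : subring A -> forall n : int, A n%:~R.
Proof.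
move=> hA [n|n]; first exact: subring_nat.
by rewrite NegzE mulrNz; apply: subringN=> //; apply: subring_nat.
Qed.

Lemma ideal_sub A I : ideal A I -> qsubset I A. Proof. by case. Qed.
Lemma ideal0 A I : ideal A I -> I 0. Proof. by case=> _ []. Qed.
Lemma idealB A I : ideal A I -> forall x y, I x -> I y -> I (x - y).
Proof. by case=> _ [_ []]. Qed.
Lemma idealM A I : ideal A I -> forall x y, A x -> I y -> I (x * y).
Proof. by case=> _ [_ []]. Qed.
Lemma idealMr A I : ideal A I -> forall x y, I x -> A y -> I (x * y).
Proof. by move=> hI x y Ix Ay; rewrite mulrC; apply: (idealM hI). Qed.
Lemma idealN A I : ideal A I -> forall x, I x -> I (- x).
Proof. by move=> hI x Ix; rewrite -sub0r; apply: (idealB hI)=> //; apply: (ideal0 hI). Qed.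
Lemma idealD A I : ideal A I -> forall x y, I x -> I y -> I (x + y).
Proof.
by move=> hI x y Ix Iy; rewrite -[y]opprK; apply: (idealB hI)=> //; apply: (idealN hI).
Qed.

Lemma maximal_is_ideal A M : maximal_ideal A M -> ideal A M. Proof. by case. Qed.
Lemma maximal_proper A M : maximal_ideal A M -> proper M. Proof. by case=> _ []. Qed.

Lemma exists_maximal A I : subring A -> ideal A I -> proper I ->
  exists M, maximal_ideal A M /\ qsubset I M.
Proof.
move=> hA hI pI.
(* Zorn's lemma also asks about the empty chain, whose union is empty and not an ideal. Adjoining
   [I] to every set turns that union into [I] itself. *)
pose J (X : Q -> Prop) : Q -> Prop := fun x => X x \/ I x.
pose P (X : Q -> Prop) := ideal A (J X) /\ proper (J X).
have J0 : J set0 = I.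
  by apply/funext=> x; apply/propext; split=> [[]//|]; right.
have [F FP totF|X [[idX prX] maxX]] := @Zorn_bigcup Q P.
  pose U := (\bigcup_(X in F) X)%classic.
  have pick2 x y : J U x -> J U y ->
      exists Z, [/\ P Z, qsubset Z U, J Z x & J Z y].
    have subU X : F X -> qsubset X U by move=> FX t Xt; exists X.
    move=> [[X FX Xx]|Ix] [[Y FY Yy]|Iy].
    - case: (totF X Y FX FY) => h.
      + by exists Y; split; [exact: FP|exact: subU|left; exact: h|left].
      + by exists X; split; [exact: FP|exact: subU|left|left; exact: h].
    - by exists X; split; [exact: FP|exact: subU|left|right].
    - by exists Y; split; [exact: FP|exact: subU|right|left].
    - by exists set0; split; [rewrite /P J0|move=> t []|right|right].
  split.
    split=> [x Jx|].
      by have [Z [[hZ _] _ Zx _]] := pick2 x x Jx Jx; apply: (ideal_sub hZ).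
    split; first by right; apply: (ideal0 hI).
    split=> [x y Jx Jy|a x Aa Jx].
      have [Z [[hZ _] sZ Zx Zy]] := pick2 x y Jx Jy.
      by case: (idealB hZ Zx Zy); [left; apply: sZ|right].
    have [Z [[hZ _] sZ Zx _]] := pick2 x x Jx Jx.
    by case: (idealM hZ Aa Zx); [left; apply: sZ|right].
  by move=> J1; have [Z [[_ pZ] _ Z1 _]] := pick2 1 1 J1 J1.
exists (J X); split; last by right.
split=> //; split=> // K hK pK sK x Kx; left; apply: contrapT => nXx.
have JK : J K = K.
  by apply/funext=> y; apply/propext; split=> [[//|Iy]|]; [apply: sK; right|left].
apply: (maxX K); last by rewrite /P JK.
split=> [y Xy|KX]; first by apply: sK; left.
exact/nXx/KX.
Qed.

Lemma maximal_comaximal A M z : subring A -> maximal_ideal A M -> A z -> ~ M z ->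
  exists b, A b /\ M (1 - z * b).
Proof.
move=> hA mM Az nMz; have hM := maximal_is_ideal mM.
pose J (x : Q) := exists a n, [/\ A a, M n & x = n + z * a].
suff [b [n [Ab Mn e]]] : J 1 by exists b; split=> //; rewrite e addrK.
apply: contrapT => pJ; apply: nMz.
case: mM => _ [_ /(_ J)]; apply=> //.
- split=> [x [a [n [Aa Mn ->]]]|].
    by apply: subringD=> //; [apply: (ideal_sub hM)|apply: subringM].
  split; first by exists 0, 0; split; [exact: subring0|exact: (ideal0 hM)|ring].
  split=> [x y [a [n [Aa Mn ->]]] [b [p [Ab Mp ->]]]|c x Ac [a [n [Aa Mn ->]]]].
    by exists (a - b), (n - p); split; [exact: subringB|exact: (idealB hM)|ring].
  by exists (c * a), (c * n); split; [exact: subringM|exact: (idealM hM)|ring].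
- by move=> x Mx; exists 0, x; split=> //; [exact: subring0|ring].
- by exists 1, 0; split; [exact: subring1|exact: (ideal0 hM)|ring].
Qed.

Lemma maximal_prime A M x y : subring A -> maximal_ideal A M -> A x -> A y ->
  M (x * y) -> M x \/ M y.
Proof.
move=> hA mM Ax Ay Mxy; have hM := maximal_is_ideal mM.
case: (EM (M x)) => [|nMx]; [by left|right].
have [b [Ab Mb]] := maximal_comaximal hA mM Ax nMx.
have -> : y = y * (1 - x * b) + b * (x * y) by ring.
by apply: (idealD hM); apply: (idealM hM).
Qed.

Lemma maximal_unit A x : subring A -> A x ->
  (forall M, maximal_ideal A M -> ~ M x) -> exists y, A y /\ x * y = 1.
Proof.
move=> hA Ax nM; pose I (z : Q) := exists a, A a /\ z = x * a.
suff [y [Ay e]] : I 1 by exists y.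
apply: contrapT => pI.
have [|M [mM sM]] := exists_maximal hA _ pI.
  split=> [z [a [Aa ->]]|]; first exact: subringM.
  split; first by exists 0; rewrite mulr0; split=> //; exact: subring0.
  split=> [y z [a [Aa ->]] [b [Ab ->]]|c z Ac [a [Aa ->]]].
    by exists (a - b); split; [exact: subringB|ring].
  by exists (c * a); split; [exact: subringM|ring].
by apply: (nM M mM); apply: sM; exists 1; rewrite mulr1; split=> //; exact: subring1.
Qed.

Lemma maximal_eq A M N : maximal_ideal A M -> maximal_ideal A N -> qsubset M N -> M = N.
Proof.
move=> [hM [pM maxM]] [hN [pN _]] s; apply: set_eqP => x; split; first exact: s.
exact: maxM.
Qed.

Lemma Jac_ideal A : subring A -> ideal A (Jac A).
Proof.
move=> hA; split=> [x [] //|].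
split; first by split=> [|M /maximal_is_ideal hM]; [exact: subring0|exact: (ideal0 hM)].
split=> [x y [Ax Jx] [Ay Jy]|a x Aa [Ax Jx]].
  split=> [|M mM]; first exact: subringB.
  by apply: (idealB (maximal_is_ideal mM)); [exact: Jx|exact: Jy].
split=> [|M mM]; first exact: subringM.
by apply: (idealM (maximal_is_ideal mM)) => //; exact: Jx.
Qed.

Lemma local_Jac A M : maximal_ideal A M -> (forall N, maximal_ideal A N -> N = M) ->
  Jac A = M.
Proof.
move=> mM uM; apply: set_eqP => x; split=> [[_ /(_ M mM)]//|Mx].
split=> [|N /uM -> //]; exact: (ideal_sub (maximal_is_ideal mM)).
Qed.

Lemma exactly_three_family A : exactly_three_maximal A <->
  exists N : 'I_3 -> Q -> Prop, [/\ forall i, maximal_ideal A (N i), injective N &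
    forall M, maximal_ideal A M -> exists i, M = N i].
Proof.
split=> [[M1 [M2 [M3 [[m1 m2 m3] [[n12 n13 n23] al]]]]]|[N [mN iN aN]]].
  (* The default value [M3] of [nth] serves as the entry of index 2. *)
  pose N (i : 'I_3) := nth M3 [:: M1; M2] i.
  have neq (X Y : Q -> Prop) : ~ set_eq X Y -> X = Y -> False.
    by move=> n e; apply: n; rewrite e.
  exists N; split=> [[[|[|[|]]]]//|[[|[|[|//]]] hi] [[|[|[|//]]] hj]|M].
  - by move=> _; apply/val_inj.
  - by move/(neq _ _ n12).
  - by move/(neq _ _ n13).
  - by move/esym/(neq _ _ n12).
  - by move=> _; apply/val_inj.
  - by move/(neq _ _ n23).
  - by move/esym/(neq _ _ n13).
  - by move/esym/(neq _ _ n23).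
  - by move=> _; apply/val_inj.
  - case/al => [|[]] /set_eqP ->.
    + by exists (inord 0); rewrite /N inordK.
    + by exists (inord 1); rewrite /N inordK.
    + by exists (inord 2); rewrite /N inordK.
exists (N (inord 0)), (N (inord 1)), (N (inord 2)); split; first by split.
have neq (i j : nat) : (i < 3)%N -> (j < 3)%N -> i <> j ->
    ~ set_eq (N (inord i)) (N (inord j)).
  move=> hi hj nij /set_eqP /iN /(congr1 val); by rewrite /= !inordK.
split; first by split; apply: neq.
move=> M /aN [i ->].
have -> : i = inord i by apply/val_inj; rewrite /= inordK.
by case: i => [[|[|[|//]]] hi] /=; [left|right; left|right; right].
Qed.

(** For each [j] other than [i], maximality gives an element of [N j] outside [N i]. The product of
    these stays outside the prime ideal [N i], and multiplying it by an inverse modulo [N i] gives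
    [e]. *)
Lemma maximal_crt A n (N : 'I_n -> Q -> Prop) (i : 'I_n) : subring A ->
  (forall j, maximal_ideal A (N j)) -> injective N ->
  exists e, [/\ A e, N i (1 - e) & forall j, j != i -> N j e].
Proof.
move=> hA mN iN; have hN j := maximal_is_ideal (mN j).
have /choice[x hx] : forall j, exists x, A x /\ (j != i -> N j x /\ ~ N i x).
  move=> j; case: (eqVneq j i) => [_|nji]; first by exists 0; split=> //; exact: subring0.
  apply: contrapT => nx.
  move/eqP: nji; apply; apply: iN; apply: (@maximal_eq A)=> // x Nx.
  apply: contrapT => nNx; apply: nx; exists x; split=> //.
  exact: (ideal_sub (hN j)).
pose p := \prod_(j | j != i) x j.
have Ap : A p.
  by apply: (big_ind A) => [|u v|j _]; [exact: subring1|exact: subringM|exact: (hx j).1].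
have nNp : ~ N i p.
  suff [_] : A p /\ ~ N i p by [].
  apply: (big_ind (fun u => A u /\ ~ N i u)) => [|u v [Au nu] [Av nv]|j nji].
  - by split; [exact: subring1|exact: (maximal_proper (mN i))].
  - split; first exact: subringM.
    by case/(maximal_prime hA (mN i) Au Av).
  - by case: (hx j) => ? /(_ nji)[].
have [b [Ab Nb]] := maximal_comaximal hA (mN i) Ap nNp.
exists (p * b); split=> // [|j nji]; first exact: subringM.
apply: (idealMr (hN j))=> //; rewrite /p (bigD1 j) //=.
apply: (idealMr (hN j)); first by case: (hx j) => _ /(_ nji)[].
by apply: (big_ind A) => [|u v|k _]; [exact: subring1|exact: subringM|exact: (hx k).1].
Qed.

Lemma Eset_subring I : I 0 -> (forall x y, I x -> I y -> I (x - y)) -> subring (Eset I).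
Proof.
move=> I0 IB; split; first by move=> x _; rewrite mul0r.
split; first by move=> x; rewrite mul1r.
split=> x y Ex Ey z Iz; first by rewrite mulrBl; apply: IB; [exact: Ex|exact: Ey].
by rewrite -mulrA; apply/Ex/Ey.
Qed.

Lemma ideal_Eset A I : ideal A I -> qsubset A (Eset I).
Proof. by move=> hI x Ax y Iy; apply: (idealM hI). Qed.

Lemma Rseq_subring A n : subring A -> subring (Rseq A n).
Proof.
move=> hA; elim: n => //= n IH; have hJ := Jac_ideal IH.
by apply: Eset_subring; [exact: (ideal0 hJ)|exact: (idealB hJ)].
Qed.

Lemma Rseq_mono A m n : subring A -> (m <= n)%N -> qsubset (Rseq A m) (Rseq A n).
Proof.
move=> hA; elim: n => [|n IH]; first by rewrite leqn0 => /eqP ->.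
rewrite leq_eqVlt => /predU1P[-> //|]; rewrite ltnS => /IH h x /h.
by apply: ideal_Eset; apply: Jac_ideal; exact: Rseq_subring.
Qed.

Lemma Rinfty_subring A : subring A -> subring (Rinfty A).
Proof.
move=> hA; have hR n := Rseq_subring n.+1 hA.
have join x y : Rinfty A x -> Rinfty A y -> exists n, Rseq A n.+1 x /\ Rseq A n.+1 y.
  move=> [m xm] [n yn]; exists (maxn m n).
  by split; [move: xm|move: yn]; apply: Rseq_mono=> //; rewrite ltnS ?leq_maxl ?leq_maxr.
split; first by exists 0; apply: subring0 (hR 0).
split; first by exists 0; apply: subring1 (hR 0).
split=> x y hx hy; have [n [xn yn]] := join x y hx hy; exists n.
  exact: (subringB (hR n) xn yn).
exact: (subringM (hR n) xn yn).
Qed.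

Lemma F2P (z : 'F_2) : z = 0 \/ z = 1.
Proof. by case: z => [[|[|//]] h]; [left|right]; apply/val_inj. Qed.

Definition F2_hom A (f : Q -> 'F_2) :=
  [/\ f 1 = 1, forall x y, A x -> A y -> f (x + y) = f x + f y &
      forall x y, A x -> A y -> f (x * y) = f x * f y].

Lemma F2_hom_quotient A M : subring A -> ideal A M -> proper M ->
  (forall x, A x -> M x \/ M (1 - x)) ->
  exists f, F2_hom A f /\ forall x, A x -> (M x <-> f x = 0).
Proof.
move=> hA hM pM alt; pose f x : 'F_2 := if `[< M x >] then 0 else 1.
have fM x : M x -> f x = 0 by rewrite /f; case: asboolP.
have fN x : M (1 - x) -> f x = 1.
  rewrite /f; case: asboolP => // Mx M1x; case: pM.
  by rewrite -(subrK x 1); apply: (idealD hM).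
exists f; split; last first.
  move=> x Ax; split; first exact: fM.
  by case: (alt _ Ax) => // /fN -> /eqP; rewrite oner_eq0.
split.
- by apply: fN; rewrite subrr; exact: (ideal0 hM).
- move=> x y Ax Ay; case: (alt _ Ax) => Mx; case: (alt y Ay) => My.
  + by rewrite !fM ?addr0 //; apply: (idealD hM).
  + rewrite (fM x) // !fN ?add0r // opprD addrCA; apply: (idealD hM)=> //.
    exact: (idealN hM).
  + rewrite (fM y) // !fN ?addr0 // opprD addrA; apply: (idealB hM)=> //.
  + rewrite (fN x) // (fN y) //.
    have e2 : (1 + 1 = 0 :> 'F_2) by apply/val_inj.
    rewrite e2; apply: fM; case: (alt _ (subringD hA Ax Ay)) => // h; case: pM.
    have -> : 1 = (1 - x) + (1 - y) - (1 - (x + y)) by ring.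
    by apply: (idealB hM)=> //; apply: (idealD hM).
- move=> x y Ax Ay; case: (alt _ Ax) => Mx.
    by rewrite (fM x) // mul0r fM //; apply: (idealMr hM).
  case: (alt y Ay) => My.
    by rewrite (fM y) // mulr0 fM //; apply: (idealM hM).
  rewrite !fN ?mulr1 //.
  have -> : 1 - x * y = (1 - x) + x * (1 - y) by ring.
  by apply: (idealD hM)=> //; apply: (idealM hM).
Qed.

Lemma alternative_maximal A M : subring A -> ideal A M -> proper M ->
  (forall x, A x -> M x \/ M (1 - x)) -> maximal_ideal A M.
Proof.
move=> hA hM pM alt; split=> //; split=> // J hJ pJ sJ x Jx.
case: (alt x (ideal_sub hJ Jx)) => // /sJ h; case: pJ.
by rewrite -(subrK x 1); apply: (idealD hJ).
Qed.

End Ideals.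

(** * Modules over a subring of [Q] and dual bases of projective ideals *)

Lemma sval_eq (T : Type) (P : T -> Prop) (u v : {x | P x}) : sval u = sval v -> u = v.
Proof. by case: u v => [x Px] [y Py] /= xy; apply: eq_exist. Qed.

Section SubEmodule.
Variables (Q : comNzRingType) (E : Q -> Prop) (V : lmodType Q) (W : V -> Prop).
Hypotheses (hE : subring E) (W0 : W 0) (WB : forall x y, W x -> W y -> W (x - y)).
Hypothesis WZ : forall a x, E a -> W x -> W (a *: x).

(* An [Emodule] needs an action of all of [Q]; scalars outside [E] act as [0]. *)
Let clip (a : Q) : Q := if `[< E a >] then a else 0.

Let clipE a : E (clip a).
Proof. by rewrite /clip; case: asboolP => // _; apply: subring0. Qed.

Let clip_id a : E a -> clip a = a.
Proof. by rewrite /clip; case: asboolP. Qed.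

Let WN x : W x -> W (- x).
Proof. by move=> Wx; rewrite -sub0r; apply: WB. Qed.

Let WD x y : W x -> W y -> W (x + y).
Proof. by move=> Wx Wy; rewrite -[y]opprK; apply/WB/WN. Qed.

Definition subEmodule : Emodule E.
refine (@EModule Q E {v | W v}
  (fun u v => exist W (sval u + sval v) (WD (svalP u) (svalP v)))
  (exist W 0 W0)
  (fun u => exist W (- sval u) (WN (svalP u)))
  (fun a u => exist W (clip a *: sval u) (WZ (clipE a) (svalP u))) _ _ _ _ _ _ _ _).
- by move=> x y z; apply: sval_eq; rewrite /= addrA.
- by move=> x y; apply: sval_eq; rewrite /= addrC.
- by move=> x; apply: sval_eq; rewrite /= add0r.
- by move=> x; apply: sval_eq; rewrite /= addNr.
- by move=> x; apply: sval_eq; rewrite /= clip_id ?scale1r //; apply: subring1.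
- by move=> a b x Ea Eb; apply: sval_eq; rewrite /= !clip_id ?scalerA //; apply: subringM.
- by move=> a x y Ea; apply: sval_eq; rewrite /= scalerDr.
- by move=> a b x Ea Eb; apply: sval_eq; rewrite /= !clip_id ?scalerDl //; apply: subringD.
Defined.

Lemma sval_madd (u v : subEmodule) : sval (madd u v) = sval u + sval v.
Proof. by []. Qed.

Lemma sval_mact a (u : subEmodule) : E a -> sval (mact a u) = a *: sval u.
Proof. by move=> Ea /=; rewrite clip_id. Qed.

End SubEmodule.

Section DualBasis.
Variables (Q : comNzRingType) (E P : Q -> Prop).
Hypotheses (hE : subring E) (P0 : P 0) (PB : forall x y, P x -> P y -> P (x - y)).
Hypotheses (PM : forall a x, E a -> P x -> P (a * x)) (PE : qsubset P E).

(* Pairs [(f, q)] where [f] is an element of the free [E]-module on the set [P],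
   viewed as a finitely supported function, and [q] is its image in [P]. *)
Let V : lmodType Q := ((Q -> Q^o) * Q^o)%type.
Let free_graph (v : V) := exists s : seq (Q * Q),
  [/\ forall c, c \in s -> E c.1 /\ P c.2,
      v.1 = (fun z => \sum_(c <- s) c.1 * (c.2 == z)%:R) &
      v.2 = \sum_(c <- s) c.1 * c.2].

Let free_graph0 : free_graph 0.
Proof.
exists [::]; split=> //; last by rewrite big_nil.
by apply/funext => z; rewrite big_nil.
Qed.

Let free_graphB x y : free_graph x -> free_graph y -> free_graph (x - y).
Proof.
move=> [s [hs fs qs]] [t [ht ft qt]].
exists (s ++ [seq (- c.1, c.2) | c <- t]); split.
- move=> c; rewrite mem_cat => /orP[/hs //|/mapP[d /ht [Ed Pd] ->]] /=.
  by split=> //; apply: subringN.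
- apply/funext => z; rewrite big_cat big_map [LHS](_ : _ = x.1 z - y.1 z) // fs ft -sumrN.
  by congr (_ + _); apply: eq_bigr => c _; rewrite mulNr.
- rewrite big_cat big_map [LHS](_ : _ = x.2 - y.2) // qs qt -sumrN.
  by congr (_ + _); apply: eq_bigr => c _; rewrite mulNr.
Qed.

Let free_graphZ a x : E a -> free_graph x -> free_graph (a *: x).
Proof.
move=> Ea [s [hs fs qs]]; exists [seq (a * c.1, c.2) | c <- s]; split.
- by move=> c /mapP[d /hs [Ed Pd] ->]; split=> //=; apply: subringM.
- apply/funext => z; rewrite big_map [LHS](_ : _ = a * x.1 z) // fs mulr_sumr.
  by apply: eq_bigr => c _; rewrite mulrA.
- by rewrite big_map [LHS](_ : _ = a * x.2) // qs mulr_sumr; apply: eq_bigr => c _; rewrite mulrA.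
Qed.

(** Projectivity splits the canonical surjection from the free module on [P]. The coordinates of the
    splitting are [E]-linear maps from [P] to [E], and such maps are multiplications by elements of
    [Q] because [P] contains the unit [p0]. *)
Lemma projective_dual_basis p0 t : projective_over E P -> P p0 -> p0 * t = 1 ->
  exists s : seq (Q * Q),
    (forall c, c \in s -> P c.2 /\ forall p, P p -> E (c.1 * p)) /\
    \sum_(c <- s) c.1 * c.2 = 1.
Proof.
move=> prj Pp0 p0t.
pose F := @subEmodule Q E V free_graph hE free_graph0 free_graphB free_graphZ.
pose N := @subEmodule Q E Q^o P hE P0 PB PM.
have graphP (v : F) : P (sval v).2.
  case: v => v [s [hs _ qs]] /=; rewrite qs big_seq.
  apply: (big_ind P) => // [x y Px Py|c /hs [Ec Pc]]; last exact: PM.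
  by rewrite -[y]opprK; apply: PB=> //; rewrite -sub0r; apply: PB.
pose g (v : F) : N := exist P (sval v).2 (graphP v).
pose h (p : Q) : N :=
  match pselect (P p) with left Pp => exist P p Pp | right _ => exist P 0 P0 end.
have hval p : P p -> sval (h p) = p by rewrite /h; case: pselect.
have [|y||l [[lD lZ] gl]] := prj F N g _ _ h.
- split=> [x y|a x Ea]; apply: sval_eq.
    reflexivity.
  by rewrite [RHS]sval_mact //= asboolT.
- have Py := svalP y.
  have gy : free_graph ((fun z => (sval y == z)%:R), sval y).
    exists [:: (1, sval y)]; split=> [c|/=|/=].
    + by rewrite inE => /eqP -> /=; split=> //; apply: subring1.
    + by apply/funext=> z; rewrite big_seq1 mul1r.
    + by rewrite big_seq1 mul1r.
  by exists (exist free_graph _ gy); apply: sval_eq.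
- split=> [x y Px Py|a x Ea Px]; apply: sval_eq.
    rewrite sval_madd !hval //.
    by rewrite -[y]opprK; apply: PB=> //; rewrite -sub0r; apply: PB.
  by rewrite sval_mact // !hval //; apply: PM.
pose f p : Q -> Q := (sval (l p)).1.
have fE p z : E (f p z).
  rewrite /f; case: (l p) => v [s [hs -> _]] /=; rewrite big_seq.
  apply: (big_ind E) => [|x y Ex Ey|c /hs [Ec _]]; first exact: subring0.
    exact: subringD.
  by apply: subringM=> //; apply: subring_nat.
have fZ a p z : E a -> P p -> f (a * p) z = a * f p z.
  by move=> Ea Pp; rewrite /f lZ // sval_mact.
have [s [hs fs qs]] := svalP (l p0).
have p0E : p0 = \sum_(c <- s) c.1 * c.2 by rewrite -qs -[LHS]hval // -gl.
(* The coordinate at [z] is multiplication by [f p0 z / p0]; only the finitely many [z] in the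
   support of [l p0] are kept, each of them once. *)
exists [seq (f p0 z * t, z) | z <- undup [seq c.2 | c <- s]]; split.
  move=> c /mapP[z]; rewrite mem_undup => /mapP[d /hs [Ed Pd] ->] -> /=.
  (* Both [p * f p0] and [p0 * f p] equal the value of [f] at [p * p0], since [p] and [p0] are
     scalars in [E] as well as elements of [P]. *)
  split=> // p Pp; have -> : f p0 d.2 * t * p = f p d.2.
    have -> : f p0 d.2 * t * p = t * (p * f p0 d.2) by ring.
    rewrite -fZ ?[p * p0]mulrC ?fZ //; [|exact: PE|exact: PE].
    by rewrite mulrA (mulrC t) p0t mul1r.
  exact: fE.
rewrite big_map /= -p0t [in RHS]p0E mulr_suml.
transitivity (\sum_(z <- undup [seq c.2 | c <- s]) \sum_(c <- s)
    (if c.2 == z then c.1 * c.2 * t else 0)).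
  apply: eq_bigr => z _; rewrite /f fs !mulr_suml; apply: eq_bigr => c _.
  by case: eqP => [<-|_]; rewrite ?mulr1 ?mulr0 ?mul0r // mulrAC.
rewrite exchange_big /= big_seq [RHS]big_seq; apply: eq_bigr => c cs.
rewrite -big_mkcond /= (big_rem c.2) /=; last by rewrite mem_undup map_f.
rewrite eqxx big1_seq ?addr0 // => z /andP[/eqP <-].
by rewrite mem_rem_uniq ?undup_uniq // inE eqxx.
Qed.

End DualBasis.

Ltac subr hS := solve [repeat first [ assumption
  | exact: (subring0 hS) | exact: (subring1 hS) | exact: (subring_nat hS)
  | apply: (subringB hS) | apply: (subringN hS) | apply: (subringD hS)
  | apply: (subringM hS) | apply: (subringX hS)]].

(** * Homomorphisms to ['F_2] and the quadratic relation in its cube *)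

Section F2Points.
Variables (Q : comNzRingType) (A : Q -> Prop) (f : Q -> 'F_2).
Hypotheses (hA : subring A) (hf : F2_hom A f).

Lemma F2_hom1 : f 1 = 1. Proof. by case: hf. Qed.
Lemma F2_homD x y : A x -> A y -> f (x + y) = f x + f y.
Proof. by case: hf => _ h _; exact: h. Qed.
Lemma F2_homM x y : A x -> A y -> f (x * y) = f x * f y.
Proof. by case: hf => _ _; exact. Qed.
Lemma F2_hom0 : f 0 = 0.
Proof. by apply: (addrI (f 0)); rewrite -F2_homD ?addr0 //; exact: subring0. Qed.
Lemma F2_homN x : A x -> f (- x) = - f x.
Proof.
move=> Ax; apply: (addrI (f x)); rewrite -F2_homD ?subrr ?F2_hom0 //.
exact: subringN.
Qed.
Lemma F2_homB x y : A x -> A y -> f (x - y) = f x - f y.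
Proof. by move=> Ax Ay; rewrite F2_homD ?F2_homN //; exact: subringN. Qed.
Lemma F2_hom_nat n : f n%:R = n%:R.
Proof.
elim: n => [|n IH]; first exact: F2_hom0.
by rewrite -!natr1 F2_homD ?IH ?F2_hom1 //; [exact: subring_nat|exact: subring1].
Qed.
Lemma F2_hom_int (n : int) : f n%:~R = n%:~R.
Proof.
case: n => n; first exact: F2_hom_nat.
by rewrite NegzE !mulrNz F2_homN ?F2_hom_nat //; exact: subring_nat.
Qed.
Lemma F2_homX x n : A x -> f (x ^+ n) = f x ^+ n.
Proof.
move=> Ax; elim: n => [|n IH]; first exact: F2_hom1.
by rewrite !exprS F2_homM ?IH //; exact: subringX.
Qed.

Definition F2_homE :=
  (F2_hom1, F2_hom0, F2_homB, F2_homN, F2_homD, F2_homM, F2_homX, F2_hom_nat).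

End F2Points.

Lemma forall_I3 (P : 'I_3 -> Prop) :
  (forall i, P i) <-> [/\ P (inord 0), P (inord 1) & P (inord 2)].
Proof.
split=> [h|[h0 h1 h2] i]; first by split.
have -> : i = inord i by apply/val_inj; rewrite /= inordK.
by case: i => [[|[|[|//]]] hi].
Qed.

(** The pairs [(u i, v i)] take at most three values in the affine plane over F_2. Three distinct
    points of that plane are affinely independent, so every function on them, the product included,
    is affine. The proof goes through the 64 cases. *)
Lemma F2_cube_quadratic (u v : 'I_3 -> 'F_2) : exists a b c : bool,
  forall i, u i * v i = u i * a%:R + v i * b%:R + c%:R.
Proof.
suff h : forall u0 u1 u2 v0 v1 v2 : 'F_2, exists a b c : bool,
    [/\ u0 * v0 = u0 * a%:R + v0 * b%:R + c%:R,
        u1 * v1 = u1 * a%:R + v1 * b%:R + c%:R &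
        u2 * v2 = u2 * a%:R + v2 * b%:R + c%:R].
  have [a [b [c habc]]] := h (u (inord 0)) (u (inord 1)) (u (inord 2))
    (v (inord 0)) (v (inord 1)) (v (inord 2)).
  by exists a, b, c; apply/forall_I3.
move=> u0 u1 u2 v0 v1 v2.
by case: (F2P u0) => ->; case: (F2P u1) => ->; case: (F2P u2) => ->;
   case: (F2P v0) => ->; case: (F2P v1) => ->; case: (F2P v2) => ->;
   first [ exists false, false, false; split; exact: val_inj
         | exists true, false, false; split; exact: val_inj
         | exists false, true, false; split; exact: val_inj
         | exists true, true, false; split; exact: val_inj
         | exists false, false, true; split; exact: val_inj
         | exists true, false, true; split; exact: val_inj
         | exists false, true, true; split; exact: val_inj
         | exists true, true, true; split; exact: val_inj ].
Qed.

(** * From the overring [S] to the quadratic ring [R] *)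

Lemma principal_maximal_inj (Q : comNzRingType) (A M N : Q -> Prop) m : subring A ->
  maximal_ideal A M -> maximal_ideal A N -> M <> N ->
  (forall x, M x <-> exists s, A s /\ x = m * s) -> ~ N m.
Proof.
move=> hA mM mN nMN pm Nm; apply: nMN; apply: (@maximal_eq _ A) => // x /pm[s [As ->]].
exact: (idealMr (maximal_is_ideal mN)).
Qed.

(** Multiplication by the unit [m] identifies [E] with [P], so one preimage [x0] of [h m] determines
    a lift. *)
Lemma cyclic_projective (Q : comNzRingType) (E P : Q -> Prop) m t : subring E ->
  m * t = 1 -> (forall x, P x <-> exists s, E s /\ x = m * s) -> projective_over E P.
Proof.
move=> hE mt pm M N g [gD gZ] gsurj h [hD hZ].
have Pt x : P x -> E (x * t).
  by move=> /pm[s [Es ->]]; rewrite mulrAC mt mul1r.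
have [x0 gx0] := gsurj (h m).
have Pm : P m by apply/pm; exists 1; split; [exact: subring1|rewrite mulr1].
exists (fun x => mact (x * t) x0); split; last first.
  move=> x Px; rewrite gZ; last exact: Pt.
  rewrite gx0 -hZ //; last exact: Pt.
  by rewrite -mulrA [t * m]mulrC mt mulr1.
split=> [x y Px Py|a x Ea Px]; first by rewrite mulrDl mactDl; [|exact: Pt..].
by rewrite mactA -?mulrA; [|exact: Ea|exact: Pt].
Qed.

Section Sufficiency.
Variables (Q : comNzRingType) (R S : Q -> Prop).
Hypotheses (hQ : total_quotient_ring R) (hloc : local_ring R).
Hypothesis hreg : forall M, maximal_ideal R M -> regular_ideal R M.
Hypotheses (hS : subring S) (RS : qsubset R S) (hS3 : exactly_three_maximal S).
Hypothesis hSmax : forall M, maximal_ideal S M ->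
  [/\ principal_ideal S M, regular_ideal S M & residue_field_F2 S M].
Hypothesis hRS : forall x, R x <-> exists k j, [/\ prime_subring k, Jac S j & x = k + j].

Lemma three_F2_points : exists f : 'I_3 -> Q -> 'F_2,
  (forall i, F2_hom S (f i)) /\
  (forall x, Jac S x <-> S x /\ forall i, f i x = 0).
Proof.
have [N [mN iN aN]] := (exactly_three_family S).1 hS3.
have /choice[f hf] : forall i, exists f, F2_hom S f /\ forall x, S x -> (N i x <-> f x = 0).
  move=> i; have [_ _ [f [f1 fD fM _ fk]]] := hSmax (mN i).
  by exists f; split.
exists f; split=> [i|x]; first by case: (hf i).
split=> [[Sx Jx]|[Sx f0]]; split=> //.
  by move=> i; apply/((hf i).2 x Sx); apply: Jx; exact: mN.
by move=> M /aN[i ->]; apply/((hf i).2 x Sx).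
Qed.

(** The generators are divided out one at a time: if [x = m i0 * s] lies in the prime ideal [N i1],
    then so does [s], because [m i0] does not; the same argument then applies to [N i2]. *)
Lemma Jac_principal : exists m, [/\ Jac S m, nzd_in S m &
  forall x, Jac S x <-> exists s, S s /\ x = m * s].
Proof.
have [N [mN iN aN]] := (exactly_three_family S).1 hS3.
have hN i := maximal_is_ideal (mN i).
have /choice[m hm] : forall i, exists m,
    nzd_in S m /\ forall x, N i x <-> exists s, S s /\ x = m * s.
  move=> i; have [[m [Sm pm]] [x [/pm[s [Ss ->]] [_ nzx]]] _] := hSmax (mN i).
  exists m; split=> //; split=> // y Sy my; apply: nzx=> //.
  by rewrite mulrAC my mul0r.
have nN i j : i != j -> ~ N j (m i).
  move=> /eqP nij; apply: (principal_maximal_inj hS (mN i) (mN j) _ (hm i).2).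
  by move/iN.
have Sm i : S (m i) by case: (hm i) => -[].
have nz i x : S x -> m i * x = 0 -> x = 0 by case: (hm i) => -[_ h] _; exact: h.
have Nm i : N i (m i).
  by apply/(hm i).2; exists 1; split; [exact: subring1|rewrite mulr1].
pose i0 : 'I_3 := inord 0; pose i1 : 'I_3 := inord 1; pose i2 : 'I_3 := inord 2.
have [S0 S1 S2] : [/\ S (m i0), S (m i1) & S (m i2)] by split.
have n01 : i0 != i1 by rewrite -val_eqE /= !inordK.
have n02 : i0 != i2 by rewrite -val_eqE /= !inordK.
have n12 : i1 != i2 by rewrite -val_eqE /= !inordK.
have J3 x : Jac S x <-> S x /\ [/\ N i0 x, N i1 x & N i2 x].
  split=> [[Sx Jx]|[Sx h]]; first by split=> //; split; exact: (Jx _ (mN _)).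
  by split=> // M /aN[i ->]; move: i; apply/forall_I3.
exists (m i0 * m i1 * m i2); split.
- apply/J3; split; first by subr hS.
  split; last by apply: (idealM (hN i2)) => //; subr hS.
    by rewrite -mulrA; apply: (idealMr (hN i0)) => //; subr hS.
  by apply: (idealMr (hN i1)) => //; apply: (idealM (hN i1)).
- split=> [|x Sx]; first by subr hS.
  by rewrite -!mulrA => /nz h; apply: nz (nz _ _ _ (h _)); subr hS.
- move=> x; split=> [/J3[Sx [/(hm i0).2[s [Ss xs]] N1 N2]]|[s [Ss ->]]].
    move: N1; rewrite xs => /(maximal_prime hS (mN i1) (Sm i0) Ss)[/(nN _ _ n01)//|].
    move=> /(hm i1).2[s' [Ss' ss']]; move: N2; rewrite xs ss' mulrA.
    move/(maximal_prime hS (mN i2) (subringM hS (Sm i0) (Sm i1)) Ss')=> [|].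
      by case/(maximal_prime hS (mN i2) (Sm i0) (Sm i1)) => [/(nN _ _ n02)|/(nN _ _ n12)].
    by move=> /(hm i2).2[s'' [Ss'' ->]]; exists s''; split=> //; ring.
  apply/J3; split; first by subr hS.
  split; first by rewrite -!mulrA; apply: (idealMr (hN i0)) => //; subr hS.
    have -> : m i0 * m i1 * m i2 * s = m i0 * m i2 * s * m i1 by ring.
    by apply: (idealM (hN i1)) => //; subr hS.
  by rewrite mulrAC; apply: (idealM (hN i2)) => //; subr hS.
Qed.

Let hR : subring R. Proof. by case: hQ. Qed.

Lemma Jac_sub_R : qsubset (Jac S) R.
Proof.
move=> x Jx; apply/hRS; exists 0, x; split=> //; last by rewrite add0r.
by exists 0.
Qed.

(** An integer has the same value at all three points and [Jac S] vanishes there, so an element of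
    [k + Jac S] is constantly 0 or constantly 1. *)
Lemma R_mod_Jac x : R x -> Jac S x \/ Jac S (1 - x).
Proof.
have [f [hf Jf]] := three_F2_points.
move=> /hRS[_ [j [[n ->] Jj ->]]]; have /Jf[Sj fj] := Jj.
have Sn : S n%:~R by apply: subring_int.
have fE i : f i (n%:~R + j) = n%:~R.
  by rewrite (F2_homD (hf i)) // fj addr0 (F2_hom_int hS (hf i)).
case: (F2P n%:~R) => n01; [left|right]; apply/Jf; (split=> [|i]; first by subr hS).
  by rewrite fE.
by rewrite (F2_homB hS (hf i)) ?fE ?n01 ?(F2_hom1 (hf i)) ?subrr //; subr hS.
Qed.

Lemma Jac_R_eq : Jac R = Jac S.
Proof.
have hJ := Jac_ideal hS.
have mJ : maximal_ideal R (Jac S).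
  apply: alternative_maximal hR _ _ R_mod_Jac.
    split; first exact: Jac_sub_R.
    split; first exact: (ideal0 hJ).
    split; first by move=> x y; apply: (idealB hJ).
    by move=> a x Ra; apply: (idealM hJ); exact: RS.
  have [N [mN _ _]] := (exactly_three_family S).1 hS3.
  by move=> [_ /(_ _ (mN ord0))]; apply: maximal_proper (mN ord0).
apply: local_Jac => // M mM; case: hloc => M0 [mM0 uM0].
by rewrite (set_eqP (uM0 _ mM)) (set_eqP (uM0 _ mJ)).
Qed.

Lemma local_maximal_eq M : maximal_ideal R M -> M = Jac S.
Proof.
move=> mM; rewrite -Jac_R_eq; symmetry; apply: local_Jac => // N mN.
case: hloc => M0 [_ uM0]; by rewrite (set_eqP (uM0 _ mM)) (set_eqP (uM0 _ mN)).
Qed.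

Lemma sufficiency : quadratic_ring R /\ exactly_three_maximal (Rinfty R).
Proof.
have [m [Jm [Sm nzm] pm]] := Jac_principal.
have [|t mt] := (hQ.2).1 m.
  by split=> [|x /RS]; [exact: Jac_sub_R|apply: nzm].
have hJ := Jac_ideal hS.
have ES : Eset (Jac S) = S.
  apply: set_eqP => q; split=> [Eq|Sq x Jx]; last exact: (idealM hJ).
  have /pm[s [Ss e]] := Eq m Jm.
  suff -> : q = s by [].
  (* Cancelling the unit [m] in [q * m = m * s]. *)
  by rewrite -[q]mulr1 -mt mulrA e mulrAC mt mul1r.
have RnS n : Rseq R n.+1 = S.
  by elim: n => [|n IH]; [rewrite /= Jac_R_eq|rewrite [LHS]/= -/(Rseq R n.+1) IH].
have RiS : Rinfty R = S.
  by apply: set_eqP => x; split=> [[n]|Sx]; [rewrite RnS|exists 0; rewrite RnS].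
rewrite RiS; split=> //; split=> //; split.
  move=> M mM; split; first exact: hreg.
  split; last first.
    by rewrite (local_maximal_eq mM) /stable ES; exact: cyclic_projective mt pm.
  have hM := maximal_is_ideal mM.
  split; first exact: (ideal0 hM).
  split; first by move=> x y; exact: (idealB hM).
  split; first by move=> x y; exact: (idealM hM).
  split.
    exists m; split=> [|y my]; first by rewrite (local_maximal_eq mM).
    by rewrite -[y]mul1r -mt mulrAC my mul0r.
  exists 1; split; last by move=> x Mx; rewrite mul1r; exact: (ideal_sub hM).
  by split=> [|x _]; [exact: subring1|rewrite mul1r].
have [f [hf Jf]] := three_F2_points.
move=> x y; rewrite RiS => Sx Sy.
have [a [b [c abc]]] := F2_cube_quadratic (f ^~ x) (f ^~ y).
have Rb (d : bool) : R d%:R by apply: subring_nat.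
(* The relation in the cube of F_2 lifts to [S] up to an error in [Jac S]; as [Jac S] lies in [R],
   the constant coefficient can absorb that error. *)
exists a%:R, b%:R, (c%:R + (x * y - (x * a%:R + y * b%:R + c%:R))).
split; [exact: Rb|exact: Rb| |ring].
apply: (subringD hR); first exact: Rb.
apply: Jac_sub_R; apply/Jf; split=> [|i]; first by subr hS.
by rewrite !(F2_homE hS (hf i)) ?abc ?subrr //; subr hS.
Qed.

End Sufficiency.

(** * Residue fields of a quadratic extension of a local ring *)

Section Residues.
Variables (Q : comNzRingType) (R S M : Q -> Prop).
Hypotheses (hR : subring R) (mM : maximal_ideal R M).
Hypothesis uM : forall N, maximal_ideal R N -> N = M.
Hypotheses (hS : subring S) (RS : qsubset R S) (quad : quadratic_ext R S).

Let hM := maximal_is_ideal mM.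

(** Multiplying the relation [v * v = v * a + v * b + c] by [u] expresses [v] through [u] with
    coefficients in [R]. *)
Lemma quadratic_inverse (B : Q -> Prop) u v : subring B -> qsubset R B ->
  B u -> S v -> u * v = 1 -> B v.
Proof.
move=> hB RB Bu Sv uv; have [a [b [c [Ra Rb Rc e]]]] := quad Sv Sv.
have -> : v = a + b + c * u.
  transitivity (u * v * v); first by rewrite uv mul1r.
  by rewrite -mulrA e !mulrDr !mulrA uv !mul1r [u * c]mulrC.
have [Ba [Bb Bc]] : B a /\ B b /\ B c by split; [exact: RB|split; exact: RB].
by subr hB.
Qed.

(** A quadratic substitute for lying over. If some [a] in [M] had an inverse [b] modulo [N], the
    relation of [b * b] multiplied by [a ^+ 2] would put [1 - d] in [N] for some [d] in [M], but
    [1 - d] is a unit of the local ring [R]. *)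
Lemma maximal_contract N a : maximal_ideal S N -> R a -> (N a <-> M a).
Proof.
move=> mN Ra; have hN := maximal_is_ideal mN; have Sa := RS Ra; split=> [Na|Ma].
  apply: contrapT => nMa.
  have [y [Ry ay]] : exists y, R y /\ a * y = 1.
    by apply: (maximal_unit hR Ra) => N' /uM ->.
  by apply: (maximal_proper mN); rewrite -ay; apply: (idealMr hN)=> //; apply: RS.
apply: contrapT => nNa.
have [b [Sb Nb]] := maximal_comaximal hS mN Sa nNa.
have [p [p' [q [Rp Rp' Rq e]]]] := quad Sb Sb.
have [Sp [Sp' Sq]] : S p /\ S p' /\ S q by split; [exact: RS|split; exact: RS].
pose d := a * (p + p' + q * a).
have Md : M d.
  by apply: (idealMr hM) => //; subr hR.
have Rd : R d by exact: (ideal_sub hM).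
have Nd : N (1 - d).
  have -> : 1 - d = (1 - a * b) * (1 + a * b - a * (p + p')).
    have -> : d = a * (p + p') + q * a ^+ 2 by rewrite /d; ring.
    have -> : q = b * b - b * p - b * p' by rewrite e; ring.
    ring.
  by apply: (idealMr hN)=> //; subr hS.
have [y [Ry dy]] : exists y, R y /\ (1 - d) * y = 1.
  apply: (maximal_unit hR) => [|N' /uM -> M1d]; first by subr hR.
  by apply: (maximal_proper mM); rewrite -(subrK d 1); apply: (idealD hM).
by apply: (maximal_proper mN); rewrite -dy; apply: (idealMr hN)=> //; apply: RS.
Qed.

(** Since [u * e] vanishes at [N'], the constant term of its quadratic relation lies in [N'], hence
    in [M] and in [N]. So modulo [N], where [e] is 1, [u] is a root of [X * (X - (a + b))]. *)
Lemma residue_surjective N N' e u : maximal_ideal S N -> maximal_ideal S N' ->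
  S e -> N (1 - e) -> N' e -> S u -> exists a, R a /\ N (u - a).
Proof.
move=> mN mN' Se Ne N'e Su.
have hN := maximal_is_ideal mN; have hN' := maximal_is_ideal mN'.
have SX : S (u * e) by subr hS.
have [a [b [c [Ra Rb Rc eq]]]] := quad SX SX.
have [Sa [Sb Sc]] : S a /\ S b /\ S c by split; [exact: RS|split; exact: RS].
have Nc : N c.
  apply/(maximal_contract mN Rc); apply/(maximal_contract mN' Rc).
  have -> : c = (u * u * e - u * a - u * b) * e.
    by rewrite !mulrBl; apply/eqP; rewrite eq_sym !subr_eq; apply/eqP; ring: eq.
  by apply: (idealM hN')=> //; subr hS.
have : N (u * e * (u * e - (a + b))).
  by have -> : u * e * (u * e - (a + b)) = c by ring: eq.
have S2 : S (u * e - (a + b)) by subr hS.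
move=> /(maximal_prime hS mN SX S2)[Nue|Nue].
  exists 0; split; first exact: subring0.
  have -> : u - 0 = u * e + u * (1 - e) by ring.
  by apply: (idealD hN)=> //; apply: (idealM hN).
exists (a + b); split; first by subr hR.
have -> : u - (a + b) = u * e - (a + b) + u * (1 - e) by ring.
by apply: (idealD hN)=> //; apply: (idealM hN).
Qed.

(* Squaring [e0 + a e1] forces [a] to be a root of [X^2 - X] modulo [M]. *)
Lemma residue_two_elements N0 N1 N2 e0 e1 a :
  maximal_ideal S N0 -> maximal_ideal S N1 -> maximal_ideal S N2 ->
  S e0 -> S e1 -> N0 (1 - e0) -> N1 e0 -> N2 e0 -> N0 e1 -> N1 (1 - e1) -> N2 e1 ->
  R a -> M a \/ M (1 - a).
Proof.
move=> m0 m1 m2 Se0 Se1 e00 e01 e02 e10 e11 e12 Ra; have Sa := RS Ra.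
have [h0 h1 h2] := And3 (maximal_is_ideal m0) (maximal_is_ideal m1) (maximal_is_ideal m2).
(* [X] has the values 1, [a] and 0 at [N0], [N1] and [N2]. The value 0 puts [q] in [M], the value 1
   then gives [p + p' = 1] modulo [M], and the relation at [N1] becomes [a ^+ 2 = a]. *)
pose X := e0 + a * e1; have SX : S X by subr hS.
have [p [p' [q [Rp Rp' Rq eq]]]] := quad SX SX.
have [Sp [Sp' Sq]] : S p /\ S p' /\ S q by split; [exact: RS|split; exact: RS].
have Mq : M q.
  apply/(maximal_contract m2 Rq).
  have -> : q = (X - p - p') * X by ring: eq.
  apply: (idealM h2); first by subr hS.
  by apply: (idealD h2)=> //; apply: (idealM h2).
have Rd : R (1 - p - p') by subr hR.
have Md : M (1 - p - p').
  apply/(maximal_contract m0 Rd).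
  have N0X : N0 (1 - X).
    have -> : 1 - X = (1 - e0) - a * e1 by rewrite /X; ring.
    by apply: (idealB h0)=> //; apply: (idealM h0).
  have -> : 1 - p - p' = q + (1 + X - p - p') * (1 - X) by ring: eq.
  apply: (idealD h0); first exact/(maximal_contract m0 Rq).
  by apply: (idealM h0)=> //; subr hS.
have Raa : R (a * (1 - a)) by subr hR.
apply: (maximal_prime hR mM Ra); first by subr hR.
apply/(maximal_contract m1 Raa).
have N1X : N1 (a - X).
  have -> : a - X = a * (1 - e1) - e0 by rewrite /X; ring.
  by apply: (idealB h1)=> //; apply: (idealM h1).
have -> : a * (1 - a) = a * (1 - p - p') - (a + X - p - p') * (a - X) - q by ring: eq.
apply: (idealB h1); last exact/(maximal_contract m1 Rq).
apply: (idealB h1); last by apply: (idealM h1)=> //; subr hS.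
by apply: (idealM h1)=> //; apply/(maximal_contract m1 Rd).
Qed.

End Residues.

(** * The ideal [M] and the Jacobson radical of [S] over three F_2-points *)

Lemma I3_third (i k : 'I_3) : exists l : 'I_3, l != i /\ l != k.
Proof.
by case: i => [[|[|[|//]]] ?]; case: k => [[|[|[|//]]] ?];
  first [ exists (@Ordinal 3 0 isT); split; reflexivity
        | exists (@Ordinal 3 1 isT); split; reflexivity
        | exists (@Ordinal 3 2 isT); split; reflexivity ].
Qed.

Section Semilocal.
Variables (Q : comNzRingType) (R S E M : Q -> Prop) (f : 'I_3 -> Q -> 'F_2).
Hypotheses (hR : subring R) (hS : subring S) (hE : subring E).
Hypotheses (RE : qsubset R E) (ES : qsubset E S) (quad : quadratic_ext R S).
Hypotheses (hf : forall i, F2_hom S (f i)) (hM : ideal E M) (MR : qsubset M R).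
Hypothesis fR : forall i a, R a -> (M a <-> f i a = 0).
Hypothesis f_unit : forall u, S u -> (forall i, f i u = 1) ->
  exists v, S v /\ u * v = 1.
Hypothesis f_lift : forall k, exists e, S e /\ forall i, f i e = (i == k)%:R.

Let RS : qsubset R S. Proof. by move=> x /RE /ES. Qed.
Let MS : qsubset M S. Proof. by move=> x /MR /RS. Qed.
Let fM0 i a : M a -> f i a = 0.
Proof. by move=> Ma; apply/fR => //; exact: MR. Qed.

(** At each point some term of the sum is nonzero, since the sum is 1. Pairs that work at single
    points are then patched together, one point at a time. *)
Lemma dual_product_unit (s : seq (Q * Q)) :
  (forall c, c \in s -> M c.2 /\ forall p, M p -> E (c.1 * p)) ->
  \sum_(c <- s) c.1 * c.2 = 1 ->
  exists w z, [/\ forall p, M p -> E (w * p), M z & forall i, f i (w * z) = 1].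
Proof.
move=> hs s1.
have local1 i : exists w z, [/\ forall p, M p -> E (w * p), M z & f i (w * z) = 1].
  apply: contrapT => none.
  suff [_] : S (\sum_(c <- s) c.1 * c.2) /\ f i (\sum_(c <- s) c.1 * c.2) = 0.
    by rewrite s1 (F2_hom1 (hf i)) => /eqP; rewrite oner_eq0.
  rewrite big_seq; apply: (big_ind (fun x => S x /\ f i x = 0)).
  - by split; [exact: subring0|exact: (F2_hom0 hS (hf i))].
  - move=> x y [Sx fx] [Sy fy]; split; first by subr hS.
    by rewrite (F2_homD (hf i)) // fx fy addr0.
  - move=> c /hs[Mc Dc]; split; first exact/ES/Dc.
    by case: (F2P (f i (c.1 * c.2))) => // fc; case: none; exists c.1, c.2.
suff h (l : seq 'I_3) : exists w z,
    [/\ forall p, M p -> E (w * p), M z & forall i, i \in l -> f i (w * z) = 1].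
  have [w [z [Dw Mz fwz]]] := h (enum 'I_3).
  by exists w, z; split=> // i; apply: fwz; rewrite mem_enum.
elim: l => [|i l [w [z [Dw Mz fwz]]]].
  by have [w [z [Dw Mz _]]] := local1 ord0; exists w, z; split.
case: (F2P (f i (w * z))) => fi; last first.
  by exists w, z; split=> // j; rewrite inE => /predU1P[-> //|/fwz].
have [w' [z' [Dw' Mz' fwz']]] := local1 i.
have Ed := Dw _ Mz; have [d dE] : {d | d = w * z} by exists (w * z).
rewrite -dE in fwz fi Ed.
have E1d : E (1 - d) by subr hE.
(* The weights are [d = w * z] and [1 - d]: where [d] is 1 the old pair survives, and at the new
   point, where [d] is 0, the pair [(w', z')] takes over. *)
exists (d * w + (1 - d) * w'), (d * z + (1 - d) * z'); split.
- move=> p Mp.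
  have -> : (d * w + (1 - d) * w') * p = d * (w * p) + (1 - d) * (w' * p) by ring.
  by have [E1 E2] := (Dw _ Mp, Dw' _ Mp); subr hE.
- by apply: (idealD hM); apply: (idealM hM).
move=> j; have -> : (d * w + (1 - d) * w') * (d * z + (1 - d) * z') =
    d ^+ 3 + (1 - d) ^+ 2 * (w' * z') + d * (1 - d) * (w * z' + w' * z).
  by rewrite dE; ring.
have [Sd S1 S2 S3] := And4 (ES Ed) (ES (Dw' _ Mz')) (ES (Dw _ Mz')) (ES (Dw' _ Mz)).
have Sy := subringD hS S2 S3.
move: (w' * z') (w * z' + w' * z) S1 Sy fwz' => x y Sx Sy fx.
rewrite !(F2_homE hS (hf j)); try by subr hS.
rewrite inE => /predU1P[->|/fwz ->]; last by ring.
by rewrite fi fx; ring.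
Qed.

(** The product [w * z] is 1 at every point, hence a unit of [S], and its inverse [v] lies in [E] by
    [quadratic_inverse]. Then [x = z * (w * x * v)] shows that [z] generates [M]. *)
Lemma invertible_principal p0 t : M p0 -> p0 * t = 1 -> projective_over E M ->
  exists m t', [/\ M m, m * t' = 1 & forall x, M x <-> exists s, E s /\ x = m * s].
Proof.
move=> Mp0 p0t prj.
have ME : qsubset M E by move=> x /MR /RE.
have [s [hs s1]] := projective_dual_basis hE (ideal0 hM)
  (fun x y => @idealB _ _ _ hM x y) (fun a x => @idealM _ _ _ hM a x) ME prj Mp0 p0t.
have [w [z [Dw Mz fwz]]] := dual_product_unit hs s1.
have [v [Sv uv]] := f_unit (ES (Dw _ Mz)) fwz.
have Ev := quadratic_inverse quad hE RE (Dw _ Mz) Sv uv.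
have pz x : M x <-> exists s, E s /\ x = z * s.
  split=> [Mx|[a [Ea ->]]]; last exact: (idealMr hM).
  exists (w * x * v); split; first by have := Dw _ Mx; move=> ?; subr hE.
  by transitivity (x * (w * z * v)); [rewrite uv mulr1|ring].
have /pz[a [Ea p0a]] := Mp0.
by exists z, (a * t); split=> //; rewrite mulrA -p0a.
Qed.

(* The lifts [X + j] and [Y] of the same two idempotents satisfy a relation with
   coefficients in [M] as well; subtracting the relations isolates [j * Y]. *)
Lemma Jac_mul_lift i k X Y j : i != k -> S X -> S Y -> S j ->
  (forall l, f l X = (l == i)%:R) -> (forall l, f l Y = (l == k)%:R) ->
  (forall l, f l j = 0) ->
  exists a b c d, [/\ M a, M b, M c & M d] /\ j * (Y - a) = X * b + Y * c + d.
Proof.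
move=> nik SX SY Sj fX fY fj.
(* Evaluating at the third point puts [c] in [M]; the points [i] and [k] then do the same for [a]
   and [b]. *)
have coef X' a b c : S X' -> (forall l, f l X' = (l == i)%:R) ->
    R a -> R b -> R c -> X' * Y = X' * a + Y * b + c -> [/\ M a, M b & M c].
  move=> SX' fX' Ra Rb Rc e.
  have [Sa Sb Sc] := And3 (RS Ra) (RS Rb) (RS Rc).
  have fe l : (l == i)%:R * (l == k)%:R =
      (l == i)%:R * f l a + (l == k)%:R * f l b + f l c.
    by rewrite -fX' -fY -!(F2_homE hS (hf l)) ?e //; subr hS.
  have Mc : M c.
    have [l [li lk]] := I3_third i k.
    apply/(fR l Rc); have := fe l; rewrite (negPf li) (negPf lk).
    by rewrite !mul0r !add0r.
  split=> //.
    apply/(fR i Ra); have := fe i; rewrite eqxx (negPf nik) (fM0 i Mc).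
    by rewrite mulr0 mul0r mul1r !addr0.
  apply/(fR k Rb); have := fe k; rewrite eqxx eq_sym (negPf nik) (fM0 k Mc).
  by rewrite !mul0r mul1r add0r !addr0.
have [a [b [c [Ra Rb Rc e]]]] := quad SX SY.
have SXj : S (X + j) by subr hS.
have [a' [b' [c' [Ra' Rb' Rc' e']]]] := quad SXj SY.
have fXj l : f l (X + j) = (l == i)%:R by rewrite (F2_homD (hf l)) // fj addr0.
have [Ma Mb Mc] := coef _ _ _ _ SX fX Ra Rb Rc e.
have [Ma' Mb' Mc'] := coef _ _ _ _ SXj fXj Ra' Rb' Rc' e'.
exists a', (a' - a), (b' - b), (c' - c); split; first by split=> //; apply: (idealB hM).
have -> : j * (Y - a') = (X + j) * Y - X * Y - j * a' by ring.
by rewrite e e'; ring.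
Qed.

(** [Jac_mul_lift] gives, for every point [k], a lift [y k] in [B] with [j * y k] in [K]. The sum of
    these lifts is a unit of [B], so [j] is in [K]. It is applied with [K = m S] in [B = S], and
    with [K = M] in [B = E] once the unit vectors lift to [E]. *)
Lemma Jac_sub_ideal (B K : Q -> Prop) j : subring B -> qsubset R B -> qsubset B S ->
  ideal B K -> qsubset M K ->
  (forall k, exists e, B e /\ forall i, f i e = (i == k)%:R) ->
  S j -> (forall i, f i j = 0) -> K j.
Proof.
move=> hB RB BS hK MK lift Sj fj.
have /choice[y hy] : forall k, exists y,
    [/\ B y, forall i, f i y = (i == k)%:R & K (j * y)].
  move=> k; have [i [nik _]] := I3_third k k.
  have [[X [BX fX]] [Y [BY fY]]] := (lift i, lift k).
  have [a [b [c [d [[Ma Mb Mc Md] e]]]]] :=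
    Jac_mul_lift nik (BS _ BX) (BS _ BY) Sj fX fY fj.
  exists (Y - a); split.
  - by apply: (subringB hB) => //; exact/RB/MR.
  - move=> l; rewrite (F2_homB hS (hf l)) ?fY ?(fM0 l Ma) ?subr0 //; first exact: BS.
    exact: MS.
  - rewrite e; apply: (idealD hK); last exact: MK.
    by apply: (idealD hK); apply: (idealM hK) => //; exact: MK.
pose u := \sum_k y k.
have By k : B (y k) by case: (hy k).
have Bu : B u by apply: (big_ind B) => // [|v w]; [exact: subring0|exact: subringD].
have fu i : f i u = 1.
  have -> : f i u = \sum_k f i (y k).
    rewrite /u; apply: (@proj2 (S (\sum_k y k))).
    apply: (big_rec2 (fun v w => S v /\ f i v = w)).
      by split; [exact: subring0|exact: (F2_hom0 hS (hf i))].
    move=> k v w _ [Sw <-]; have Sy := BS _ (By k).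
    by split; [subr hS|rewrite (F2_homD (hf i))].
  rewrite (bigD1 i) //= big1 => [|k nki]; first by case: (hy i) => _ -> _; rewrite eqxx addr0.
  by case: (hy k) => _ -> _; rewrite eq_sym (negPf nki).
have [v [Sv uv]] := f_unit (BS _ Bu) fu.
have Bv := quadratic_inverse quad hB RB Bu Sv uv.
rewrite -[j]mulr1 -uv mulrA; apply: (idealMr hK) => //.
rewrite mulr_sumr; apply: (big_ind K) => [|v' w|k _]; first exact: (ideal0 hK).
  exact: (idealD hK).
by case: (hy k).
Qed.

Variables (m t : Q).
Hypotheses (Mm : M m) (mt : m * t = 1).
Hypothesis pM : forall x, M x <-> exists s, E s /\ x = m * s.

Lemma Jac_eq_mS x : (S x /\ forall i, f i x = 0) <-> exists s, S s /\ x = m * s.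
Proof.
split=> [[Sx fx]|[s [Ss ->]]]; last first.
  have Sm := MS Mm; split=> [|i]; first by subr hS.
  by rewrite (F2_homM (hf i)) // (fM0 i Mm) mul0r.
pose K (x : Q) := exists s, S s /\ x = m * s.
apply: (@Jac_sub_ideal S K) => //.
- split; first by move=> y [s [Ss ->]]; have Sm := MS Mm; subr hS.
  split; first by exists 0; rewrite mulr0; split=> //; exact: subring0.
  split=> [y z [a [Sa ->]] [b [Sb ->]]|c y Sc [a [Sa ->]]].
    by exists (a - b); split; [subr hS|ring].
  by exists (c * a); split; [subr hS|ring].
- by move=> y /pM[s [Es ->]]; exists s; split=> //; exact: ES.
Qed.

(* Compare the quadratic equations of [e] and of [e + m s], and cancel [m]. *)
Lemma residue_span e s i k : S e -> S s -> f i e = 0 -> f k e = 1 ->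
  exists al be, [/\ E al, E be & forall l, f l s = f l al * f l e + f l be].
Proof.
move=> Se Ss fi fk; have Sm := MS Mm.
have coef e' a b c : S e' -> f i e' = 0 -> f k e' = 1 -> R a -> R b -> R c ->
    e' * e' = e' * a + e' * b + c -> M c /\ M (1 - (a + b)).
  move=> Se' fi' fk' Ra Rb Rc eq.
  have [Sa Sb Sc] := And3 (RS Ra) (RS Rb) (RS Rc).
  have fe l : f l e' * f l e' = f l e' * (f l a + f l b) + f l c.
    by rewrite mulrDr -!(F2_homE hS (hf l)) ?eq //; subr hS.
  have Mc : M c by apply/(fR i Rc); have := fe i; rewrite fi' !mul0r add0r.
  split=> //; apply/(fR k); first by subr hR.
  have := fe k; rewrite fk' (fM0 k Mc) addr0 !mul1r => fk1.
  by rewrite !(F2_homE hS (hf k)) -?fk1 ?subrr //; subr hS.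
have Sj : S (m * s) by subr hS.
have Sej : S (e + m * s) by subr hS.
have fj l : f l (e + m * s) = f l e.
  by rewrite (F2_homD (hf l)) // (F2_homM (hf l)) // (fM0 l Mm) mul0r addr0.
have [a [b [c [Ra Rb Rc eq]]]] := quad Se Se.
have [a' [b' [c' [Ra' Rb' Rc' eq']]]] := quad Sej Sej.
have [Mc M1] := coef _ _ _ _ Se fi fk Ra Rb Rc eq.
have [Mc' M1'] : M c' /\ M (1 - (a' + b')) by apply: (coef (e + m * s)); rewrite ?fj.
have /pM[al [Eal eal]] := idealB hM M1 M1'.
have /pM[be [Ebe ebe]] := idealB hM Mc' Mc.
exists al, be; split=> // l.
have [Sal Sbe] := (ES Eal, ES Ebe).
have [[Sa Sb Sc] [Sa' Sb' Sc']] :=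
  (And3 (RS Ra) (RS Rb) (RS Rc), And3 (RS Ra') (RS Rb') (RS Rc')).
(* This is the difference of the two relations divided by [m]. At every point the second factor on
   the left is -1, which is 1 in F_2, because [e + e] and [m * s] vanish and [a' + b'] has value
   1. *)
have key : s * (e + e + m * s - (a' + b')) = e * al + be.
  rewrite -[LHS]mul1r -[RHS]mul1r -mt ![m * t]mulrC -!(mulrA t); congr (t * _).
  transitivity ((e + m * s) * (e + m * s) - e * e - m * s * (a' + b')); first by ring.
  rewrite eq eq'.
  transitivity (e * (m * al) + m * be); last by ring.
  by rewrite -eal -ebe; ring.
have fa' : f l (a' + b') = 1.
  have S1 : S (1 - (a' + b')) by subr hS.
  rewrite -[a' + b'](subKr 1) (F2_homB hS (hf l)) ?(F2_hom1 (hf l)) ?(fM0 l M1') ?subr0 //.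
  exact: subring1.
have := congr1 (f l) key; rewrite [RHS](F2_homD (hf l)); try by subr hS.
rewrite (F2_homM (hf l) Se Sal) [f l e * _]mulrC => <-.
rewrite (F2_homM (hf l)); try by subr hS.
rewrite (F2_homB hS (hf l)); try by subr hS.
rewrite fa' !(F2_homE hS (hf l)); try by subr hS.
rewrite (fM0 l Mm) mul0r addr0.
by case: (F2P (f l s)) => ->; case: (F2P (f l e)) => ->; apply: val_inj.
Qed.

(** [residue_span] is used twice. With [e0] and [e1] it gives [be] in [E] with value 1 at [i1] and 0
    at [i2], whatever its value at [i0]. Such a [be] can replace [e0], and then both the base and
    the coefficients lie in [E]. *)
Lemma E_lift k : exists e, E e /\ forall i, f i e = (i == k)%:R.
Proof.
pose i0 : 'I_3 := inord 0; pose i1 : 'I_3 := inord 1; pose i2 : 'I_3 := inord 2.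
have n01 : (i0 == i1) = false by rewrite -val_eqE /= !inordK.
have n10 : (i1 == i0) = false by rewrite eq_sym.
have n20 : (i2 == i0) = false by rewrite -val_eqE /= !inordK.
have n21 : (i2 == i1) = false by rewrite -val_eqE /= !inordK.
have [[e0 [Se0 fe0]] [e1 [Se1 fe1]]] := (f_lift i0, f_lift i1).
have [||al [be [Eal Ebe h]]] := @residue_span e0 e1 i1 i0 Se0 Se1.
  by rewrite fe0 n10.
  by rewrite fe0 eqxx.
have fb1 : f i1 be = 1 by have := h i1; rewrite fe1 fe0 n10 eqxx mulr0 add0r => <-.
have fb2 : f i2 be = 0 by have := h i2; rewrite fe1 fe0 n20 n21 mulr0 add0r => <-.
have [e [Se fe]] := f_lift k.
have [al' [be' [Eal' Ebe' h']]] := residue_span (ES Ebe) Se fb2 fb1.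
exists (al' * be + be'); split=> [|i]; first by subr hE.
have [Sa Sb Sb'] := And3 (ES Eal') (ES Ebe) (ES Ebe').
by rewrite !(F2_homE hS (hf i)) -?h' ?fe //; subr hS.
Qed.

Lemma Jac_eq_M x : (S x /\ forall i, f i x = 0) <-> M x.
Proof.
split=> [[Sx fx]|Mx]; last by split=> [|i]; [exact: MS|exact: fM0].
by apply: (@Jac_sub_ideal E M) => //; exact: E_lift.
Qed.

(* [e] is lifted to an idempotent modulo [m^2]; then [m e + 1 - e] is a uniformizer
   at the [i]-th point and a unit at the other two. *)
Lemma point_principal i : exists p, S p /\
  forall x, (S x /\ f i x = 0) <-> exists s, S s /\ x = p * s.
Proof.
have Sm := MS Mm; have [e' [Se' fe']] := f_lift i.
(* The polynomial [3 X^2 - 2 X^3] and its complement to 1 are divisible by [X^2] and [(1 - X)^2], so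
   the error [e' * (1 - e')], a multiple of [m], gets squared. *)
pose e := 3%:R * e' ^+ 2 - 2%:R * e' ^+ 3.
have Se : S e by rewrite /e; subr hS.
have e1 k : 1 - (k == i)%:R = (k != i)%:R :> 'F_2.
  by case: (k == i); rewrite /= ?subrr ?subr0.
have fe k : f k e = (k == i)%:R.
  rewrite !(F2_homE hS (hf k)); try by subr hS.
  by rewrite fe'; case: (k == i); apply: val_inj.
have /Jac_eq_mS[w [Sw ew]] : S (e' * (1 - e')) /\ forall k, f k (e' * (1 - e')) = 0.
  split=> [|k]; first by subr hS.
  rewrite !(F2_homE hS (hf k)); try by subr hS.
  by rewrite fe'; case: (k == i); rewrite ?subrr ?mulr0 ?mul0r.
pose v := w ^+ 2 * (3%:R - 2%:R * e') * (1 + 2%:R * e').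
have Sv : S v by rewrite /v; subr hS.
have ev : e * (1 - e) = m ^+ 2 * v.
  transitivity ((m * w) ^+ 2 * (3%:R - 2%:R * e') * (1 + 2%:R * e')).
    by rewrite -ew /e; ring.
  by rewrite /v; ring.
clearbody e v; pose p := e * m + (1 - e).
have Sp : S p by rewrite /p; subr hS.
(* [u] is the quotient of [p * (e + (1 - e) * m)] by [m]; it is 1 modulo [m] because [e * (1 - e)]
   is divisible by [m ^+ 2]. *)
pose u := 1 + m * (v * (1 + m ^+ 2) - 2%:R * m * v).
have Su : S u by rewrite /u; subr hS.
have [u' [Su' uu']] : exists u', S u' /\ u * u' = 1.
  apply: f_unit => // k; rewrite (F2_homD (hf k)); try by subr hS.
  rewrite (F2_hom1 (hf k)) (F2_homM (hf k)); try by subr hS.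
  by rewrite (fM0 k Mm) mul0r addr0.
have pm : p * ((e + (1 - e) * m) * u') = m.
  rewrite mulrA; have -> : p * (e + (1 - e) * m) = m * u.
    transitivity (m * (1 - 2%:R * (e * (1 - e))) + e * (1 - e) * (1 + m ^+ 2)).
      by rewrite /p; ring.
    by rewrite ev /u; ring.
  by rewrite -mulrA uu' mulr1.
set q := (e + _) * u' in pm; have Sq : S q by rewrite /q; subr hS.
exists p; split=> // x; split=> [[Sx fx]|[s [Ss ->]]]; last first.
  split; first by subr hS.
  rewrite (F2_homM (hf i)) //.
  rewrite /p !(F2_homE hS (hf i)); try by subr hS.
  by rewrite fe (fM0 i Mm) eqxx mulr0 subrr addr0 mul0r.
have /Jac_eq_mS[y [Sy xe]] : S (x * e) /\ forall k, f k (x * e) = 0.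
  split=> [|k]; first by subr hS.
  rewrite (F2_homM (hf k)) // fe; case: eqP => [->|_]; last exact: mulr0.
  by rewrite fx mul0r.
(* Split [x] as [x * e + x * (1 - e)]: the first term is [m * y] with [m = p * q], and
   [1 - e = p * (1 - e * q)]. *)
exists (q * y + x * (1 - e * q)); split; first by subr hS.
transitivity (x * e + x * (1 - e)); first by ring.
rewrite xe -pm.
have -> : 1 - e = p - e * (p * q) by rewrite pm /p; ring.
by ring.
Qed.

End Semilocal.

(** * From the quadratic ring [R] to the overring [Rinfty R] *)

Section Necessity.
Variables (Q : comNzRingType) (R : Q -> Prop).
Hypotheses (hQ : total_quotient_ring R) (hloc : local_ring R).
Hypothesis quadR : quadratic_ring R.
Hypothesis three : exactly_three_maximal (Rinfty R).

Lemma necessity : exists S : Q -> Prop,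
  [/\ subring S, qsubset R S, exactly_three_maximal S,
      (forall M, maximal_ideal S M ->
         [/\ principal_ideal S M, regular_ideal S M & residue_field_F2 S M]) &
      (forall x, R x <-> exists k j, [/\ prime_subring k, Jac S j & x = k + j])].
Proof.
have hR : subring R by case: hQ.
have hS := Rinfty_subring hR; set S := Rinfty R in hS *.
have [M [mM uM']] := hloc.
have uM N : maximal_ideal R N -> N = M by move=> mN; apply/set_eqP/uM'.
have [_ [/(_ M mM)[[p0 [Mp0 nzp0]] [_ stM]] quad]] := quadR.
have hM := maximal_is_ideal mM.
have hE : subring (Eset M).
  by apply: Eset_subring; [exact: (ideal0 hM)|move=> x y; exact: (idealB hM)].
(* The union [Rinfty] starts at [Rseq R 1], so its index 0 already stands for [Eset (Jac R)]. *)
have ES : qsubset (Eset M) S by move=> x Ex; exists 0; rewrite /= (local_Jac mM uM).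
have RE := ideal_Eset hM.
have RS : qsubset R S by move=> x /RE /ES.
have MR : qsubset M R by move=> x; exact: (ideal_sub hM).
have [t p0t] := (hQ.2).1 p0 nzp0.
have [N [mN iN aN]] := (exactly_three_family S).1 three.
have hN i := maximal_is_ideal (mN i).
have /choice[e he] := fun i => maximal_crt i hS mN iN.
have two a : R a -> M a \/ M (1 - a).
  have [[Se0 e00 e0j] [Se1 e11 e1j]] := (he (inord 0), he (inord 1)).
  by apply: (residue_two_elements hR mM uM hS RS quad (mN (inord 0)) (mN (inord 1))
    (mN (inord 2)) Se0 Se1) => //; (apply: e0j || apply: e1j); rewrite -val_eqE /= !inordK.
have NM i a : R a -> (N i a <-> M a) := maximal_contract hR mM uM hS RS quad (mN i).
(* Modulo [N i], [x] agrees with an element of [R], which is 0 or 1 modulo [M]; so every residue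
   field of [S] is F_2. *)
have altN i x : S x -> N i x \/ N i (1 - x).
  move=> Sx; have [k [nki _]] := I3_third i i; have [Se ei ej] := he i.
  have [a [Ra Na]] :=
    residue_surjective hR mM uM hS RS quad (mN i) (mN k) Se ei (ej _ nki) Sx.
  case: (two a Ra) => Ma; [left|right].
    by rewrite -(subrK a x); apply: (idealD (hN i)) => //; apply/(NM i a Ra).
  have -> : 1 - x = (1 - a) - (x - a) by ring.
  by apply: (idealB (hN i)) => //; apply/(NM i) => //; exact: MR.
have /choice[f hfN] := fun i =>
  F2_hom_quotient hS (hN i) (maximal_proper (mN i)) (altN i).
have hf i : F2_hom S (f i) by case: (hfN i).
have fN i x : S x -> (N i x <-> f i x = 0) by move=> Sx; case: (hfN i) => _; exact.
have fR i a : R a -> (M a <-> f i a = 0).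
  by move=> Ra; rewrite -(fN i a (RS _ Ra)); symmetry; exact: NM.
have f_unit u : S u -> (forall i, f i u = 1) -> exists v, S v /\ u * v = 1.
  move=> Su fu; apply: (maximal_unit hS) => // _ /aN[i ->] /(fN i u Su) /eqP.
  by rewrite fu oner_eq0.
have f_lift k : exists x, S x /\ forall i, f i x = (i == k)%:R.
  have [Se ek ej] := he k; exists (e k); split=> // i.
  case: eqP => [->|/eqP nik]; last exact/(fN i _ Se)/ej.
  have S1 := subringB hS (subring1 hS) Se.
  move/(fN k _ S1): ek; rewrite (F2_homB hS (hf k)) ?(F2_hom1 (hf k)) //; last exact: subring1.
  by move/eqP; rewrite subr_eq0 => /eqP <-.
have hEM : ideal (Eset M) M.
  split; first by move=> x /MR /RE.
  split; first exact: (ideal0 hM).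
  by split=> [x y|a x Ea Mx]; [exact: (idealB hM)|exact: Ea].
have [m [t' [Mm mt' pM]]] := invertible_principal hS hE RE ES quad hf hEM MR f_unit
  Mp0 p0t stM.
have JM := Jac_eq_M hR hS hE RE ES quad hf hEM MR fR f_unit f_lift Mm mt' pM.
have Jf x : Jac S x <-> M x.
  rewrite -JM; split=> [[Sx Jx]|[Sx fx]]; split=> //.
    by move=> i; apply/(fN i x Sx); apply: Jx; exact: mN.
  by move=> _ /aN[i ->]; apply/(fN i x Sx).
exists S; split=> // [_ /aN[i ->]|x].
  split.
  - have [p [Sp pp]] :=
      point_principal hS RE ES quad hf hEM MR fR f_unit f_lift Mm pM i.
    exists p; split=> // x; rewrite -pp; split=> [Nx|[Sx /(fN i x Sx) //]].
    by have Sx := ideal_sub (hN i) Nx; split=> //; apply/(fN i x Sx).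
  - have Rm := MR _ Mm; exists m; split; first exact/(NM i m Rm).
    split=> [|y _ my]; first exact: RS.
    by rewrite -[y]mul1r -mt' mulrAC my mul0r.
  - exists (f i); split.
    + exact: (F2_hom1 (hf i)).
    + by move=> x y; exact: (F2_homD (hf i)).
    + by move=> x y; exact: (F2_homM (hf i)).
    + move=> z; case: (F2P z) => ->.
        by exists 0; split; [exact: subring0|exact: (F2_hom0 hS (hf i))].
      by exists 1; split; [exact: subring1|exact: (F2_hom1 (hf i))].
    + exact: fN.
split=> [Rx|[_ [j [[n ->] /Jf Mj ->]]]]; last first.
  by apply: (subringD hR); [exact: subring_int|exact: MR].
case: (two x Rx) => Mx.
  by exists 0, x; split; [exists 0|apply/Jf|rewrite add0r].
exists 1, (- (1 - x)); split; [by exists 1| |by ring].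
by apply/Jf; exact: (idealN hM).
Qed.

End Necessity.

Theorem theorem3p13 (Q : comNzRingType) (R : Q -> Prop)
  (hQ : total_quotient_ring R)
  (hloc : local_ring R)
  (hreg : forall M, maximal_ideal R M -> regular_ideal R M) :
  (quadratic_ring R /\ exactly_three_maximal (Rinfty R)) <->
  (exists S : Q -> Prop,
     [/\ subring S, qsubset R S,
         exactly_three_maximal S,
         (forall M, maximal_ideal S M ->
            [/\ principal_ideal S M, regular_ideal S M & residue_field_F2 S M]) &
         (forall x, R x <->
            exists k j, [/\ prime_subring k, Jac S j & x = k + j])]).
Proof.
split=> [[quadR three]|[S [hS RS hS3 hSmax hRS]]]; first exact: necessity.
exact: (sufficiency hQ hloc hreg hS RS hS3 hSmax hRS).
Qed.
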